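(* Let $K$ be a number field with ring of integers $\mathcal{O}_K$, and suppose that its ideal class group $\operatorname{Cl}(K)$ is cyclic of order $h$. Let $\mathfrak p_1,\ldots,\mathfrak p_m$ be nonzero prime ideals of $\mathcal{O}_K$ (not necessarily distinct) with $m\ge h$, and suppose their ideal classes occupy $t$ distinct classes, i.e. $|\{[\mathfrak p_1],\ldots,[\mathfrak p_m]\}|=t$. Put \[ B_h(t)= \min\left\{ h-t+1,\, \max\left\{\left\lfloor\frac h2\right\rfloor+1,\, h-\binom{t}{2}\right\} \right\}. \] Then there is a nonempty index set $I\subseteq\{1,\ldots,m\}$ such that \[ |I|\le B_h(t) \] and \[ \prod_{i\in I}\mathfrak p_i=(\pi) \] for some irreducible element $\pi\in\mathcal{O}_K$. If, in addition, $h\ge 5$ and $t=3$, then there is a nonempty index set $I\subseteq\{1,\ldots,m\}$ with $|I|\le h-3$ and $\prod_{i\in I}\mathfrak p_i=(\pi)$ for some irreducible element $\pi\in\mathcal{O}_K$.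
   Context: $[\mathfrak p]$ denotes the class of the ideal $\mathfrak p$ in the ideal class group $\operatorname{Cl}(K)$ of $\mathcal{O}_K$. Repeated prime ideals among $\mathfrak p_1,\ldots,\mathfrak p_m$ are counted as distinct indexed occurrences. The quantity $h-\binom{t}{2}$ is an ordinary integer difference and may be negative. *)

(* Defs.v *)
From HB Require Import structures.
From mathcomp Require Import all_boot all_order all_algebra all_field.
From mathcomp Require Import generic_quotient boolp classical_sets cardinality.

Set Implicit Arguments.
Unset Strict Implicit.
Unset Printing Implicit Defensive.

Import Order.TTheory GRing.Theory Num.Theory.
Local Open Scope ring_scope.

Section RingOfIntegers.
Variable K : fieldExtType rat.

Definition integral_elt : {pred K} :=
  [pred x | `[< integralOver (intr : int -> K) x >]].

Fact integral_elt_subring : subring_closed integral_elt.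
Proof.
split.
- exact/asboolP/(integral1 intr).
- by move=> x y /asboolP ix /asboolP iy; apply/asboolP/integral_sub.
- by move=> x y /asboolP ix /asboolP iy; apply/asboolP/integral_mul.
Qed.

HB.instance Definition _ :=
  GRing.isSubringClosed.Build K integral_elt integral_elt_subring.

Record ring_of_integers := RingOfIntegers {
  int_val :> K;
  int_valP : int_val \in integral_elt }.

HB.instance Definition _ := [isSub for int_val].
HB.instance Definition _ := [Choice of ring_of_integers by <:].
HB.instance Definition _ :=
  [SubChoice_isSubComNzRing of ring_of_integers by <:].

Implicit Types x y : ring_of_integers.

Definition int_unit : pred ring_of_integers :=
  [pred x : ring_of_integers | (x != 0) && (((x : K)^-1) \in integral_elt)].
Definition int_inv x : ring_of_integers :=
  if int_unit x then insubd x ((x : K)^-1) else x.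

Fact int_mulVx : {in int_unit, left_inverse 1 int_inv *%R}.
Proof.
move=> x ux; apply: val_inj; rewrite rmorphM rmorph1 /int_inv.
have -> : int_unit x by [].
case/andP: ux => x0 ix; by rewrite -[X in X * _]/(val _) insubdK // mulVf.
Qed.

Fact int_unitPl x y : y * x = 1 -> int_unit x.
Proof.
move=> /(congr1 val); rewrite rmorphM rmorph1 /= => yx.
have x0 : (x : K) != 0.
  by apply: contra_eq_neq yx => ->; rewrite mulr0 eq_sym oner_neq0.
apply/andP; split=> //.
have -> : (x : K)^-1 = (y : K) by apply: (mulIf x0); rewrite mulVf.
exact: int_valP.
Qed.

Fact int_inv_out : {in [predC int_unit], int_inv =1 id}.
Proof. by move=> x xu; rewrite /int_inv ifN. Qed.

HB.instance Definition _ := GRing.ComNzRing_hasMulInverse.Build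
  ring_of_integers int_mulVx int_unitPl int_inv_out.

Fact int_mulf_eq0 x y : x * y = 0 -> (x == 0) || (y == 0).
Proof.
by move=> /(congr1 val); rewrite rmorphM rmorph0 => /eqP; rewrite mulf_eq0.
Qed.

HB.instance Definition _ :=
  GRing.ComUnitRing_isIntegral.Build ring_of_integers int_mulf_eq0.

End RingOfIntegers.

Definition irreducible_elt (R : idomainType) (x : R) : Prop :=
  [/\ x != 0, x \isn't a GRing.unit &
      forall a b : R, x = a * b -> a \is a GRing.unit \/ b \is a GRing.unit].

(* The ideals of a domain R, the zero and unit ideals included (the idealr
   structure of ring_quotient only covers proper ideals). They form a
   commutative semiring for the sum and the product of ideals. *)
Section Ideals.
Variable R : idomainType.

Record ideal := Ideal {
  ideal_set :> R -> Prop;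
  ideal0 : ideal_set 0;
  idealD : forall x y, ideal_set x -> ideal_set y -> ideal_set (x + y);
  idealM : forall a x, ideal_set x -> ideal_set (a * x) }.

HB.instance Definition _ := gen_eqMixin ideal.
HB.instance Definition _ := gen_choiceMixin ideal.

Implicit Types (A B C : ideal) (a b x y : R).

Lemma ideal_inj A B : ideal_set A = ideal_set B -> A = B.
Proof.
case: A B => [A A0 AD AM] [B B0 BD BM] /= eAB.
by case: B / eAB B0 BD BM => *; congr Ideal; apply: Prop_irrelevance.
Qed.

Lemma ideal_eqP A B : (forall x, A x -> B x) -> (forall x, B x -> A x) -> A = B.
Proof.
move=> AB BA; apply: ideal_inj; apply/funext => x; apply/propext.
by split; [apply: AB | apply: BA].
Qed.

Lemma ideal_sum A (I : eqType) (s : seq I) (F : I -> R) :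
  {in s, forall i, A (F i)} -> A (\sum_(i <- s) F i).
Proof.
move=> sA; rewrite big_seq; elim/big_ind: _ => [|x y|i /sA//].
  exact: ideal0.
exact: idealD.
Qed.

Definition principal a : ideal.
Proof.
refine (@Ideal [set x | exists y, x = a * y]%classic _ _ _).
- by exists 0; rewrite mulr0.
- by move=> _ _ [y ->] [z ->]; exists (y + z); rewrite mulrDr.
- by move=> b _ [y ->]; exists (b * y); rewrite mulrCA.
Defined.

Definition ideal_add A B : ideal.
Proof.
refine (@Ideal [set z | exists x y, [/\ A x, B y & z = x + y]]%classic _ _ _).
- by exists 0, 0; rewrite addr0; split=> //; apply: ideal0.
- move=> _ _ [x [y [Ax By ->]]] [x' [y' [Ax' By' ->]]].
  by exists (x + x'), (y + y'); rewrite addrACA; split=> //; apply: idealD.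
- move=> a _ [x [y [Ax By ->]]].
  by exists (a * x), (a * y); rewrite mulrDr; split=> //; apply: idealM.
Defined.

Definition ideal_mul A B : ideal.
Proof.
refine (@Ideal [set z | exists2 s : seq (R * R),
  {in s, forall q, A q.1 /\ B q.2} & z = \sum_(q <- s) q.1 * q.2]%classic _ _ _).
- by exists [::]; rewrite ?big_nil.
- move=> _ _ [s sP ->] [s' sP' ->]; exists (s ++ s'); rewrite ?big_cat //.
  by move=> q; rewrite mem_cat => /orP[/sP|/sP'].
- move=> a _ [s sP ->]; exists [seq (a * q.1, q.2) | q <- s]; last first.
    by rewrite big_map mulr_sumr; apply: eq_bigr => q _; rewrite mulrA.
  by move=> _ /mapP[q /sP[Aq Bq] ->]; split=> //; apply: idealM.
Defined.

Lemma mem_ideal_mul A B a b : A a -> B b -> ideal_mul A B (a * b).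
Proof.
move=> Aa Bb; exists [:: (a, b)]; last by rewrite big_seq1.
by move=> q; rewrite inE => /eqP ->.
Qed.

Lemma ideal_mul_sub A B C :
  (forall a b, A a -> B b -> C (a * b)) -> forall x, ideal_mul A B x -> C x.
Proof.
by move=> ABC _ [s sP ->]; apply: ideal_sum => q /sP[Aq Bq]; apply: ABC.
Qed.

Fact ideal_addA : associative ideal_add.
Proof.
move=> A B C; apply: ideal_eqP.
- move=> _ [x [_ [Ax [y [z [By Cz ->]]] ->]]]; exists (x + y), z.
  by rewrite addrA; split=> //; exists x, y.
- move=> _ [_ [z [[x [y [Ax By ->]]] Cz ->]]]; exists x, (y + z).
  by rewrite addrA; split=> //; exists y, z.
Qed.

Fact ideal_addC : commutative ideal_add.
Proof.
by move=> A B; apply: ideal_eqP => _ [x [y [Ax By ->]]];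
  exists y, x; rewrite addrC.
Qed.

Fact ideal_add0 : left_id (principal 0) ideal_add.
Proof.
move=> A; apply: ideal_eqP => [_ [_ [y [[z ->] Ay ->]]]|x Ax].
  by rewrite mul0r add0r.
by exists 0, x; rewrite add0r; split=> //; apply: ideal0.
Qed.

Fact ideal_mulC : commutative ideal_mul.
Proof.
by move=> A B; apply: ideal_eqP; apply: ideal_mul_sub => a b Aa Bb;
  rewrite mulrC; apply: mem_ideal_mul.
Qed.

Lemma ideal_mul_sub3 A B C (D : ideal) :
  (forall a b c, A a -> B b -> C c -> D (a * b * c)) ->
  forall x, ideal_mul (ideal_mul A B) C x -> D x.
Proof.
move=> ABCD; apply: ideal_mul_sub => _ c [s sP ->] Cc.
by rewrite mulr_suml; apply: ideal_sum => q /sP[Aq Bq]; apply: ABCD.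
Qed.

Fact ideal_mulA : associative ideal_mul.
Proof.
move=> A B C; apply: ideal_eqP; last first.
  apply: ideal_mul_sub3 => a b c Aa Bb Cc; rewrite -mulrA.
  by do 2?apply: mem_ideal_mul.
rewrite ideal_mulC; apply: ideal_mul_sub3 => b c a Bb Cc Aa.
by rewrite mulrC mulrA; do 2?apply: mem_ideal_mul.
Qed.

Fact ideal_mul1 : left_id (principal 1) ideal_mul.
Proof.
move=> A; apply: ideal_eqP => [|x Ax].
  by apply: ideal_mul_sub => _ b [y ->] Ab; rewrite mul1r; apply: idealM.
by rewrite -[x]mul1r; apply: mem_ideal_mul => //; exists 1; rewrite mulr1.
Qed.

Fact ideal_mulDl : left_distributive ideal_mul ideal_add.
Proof.
move=> A B C; apply: ideal_eqP.
  apply: ideal_mul_sub => _ c [x [y [Ax By ->]]] Cc.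
  by exists (x * c), (y * c); rewrite mulrDl; split=> //; apply: mem_ideal_mul.
move=> _ [x [y [ACx BCy ->]]]; apply: idealD.
  apply: ideal_mul_sub ACx => a c Aa Cc; apply: mem_ideal_mul => //.
  by exists a, 0; rewrite addr0; split=> //; apply: ideal0.
apply: ideal_mul_sub BCy => b c Bb Cc; apply: mem_ideal_mul => //.
by exists 0, b; rewrite add0r; split=> //; apply: ideal0.
Qed.

Fact ideal_mul0 : left_zero (principal 0) ideal_mul.
Proof.
move=> A; apply: ideal_eqP => [|_ [y ->]]; last by rewrite mul0r; apply: ideal0.
by apply: ideal_mul_sub => _ b [y ->] _; exists 0; rewrite !mul0r.
Qed.

HB.instance Definition _ :=
  GRing.isNmodule.Build ideal ideal_addA ideal_addC ideal_add0.
HB.instance Definition _ := GRing.Nmodule_isComPzSemiRing.Build ideal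
  ideal_mulA ideal_mulC ideal_mul1 ideal_mulDl ideal_mul0.

Definition prime_ideal A : Prop :=
  ~ A 1 /\ forall x y, A (x * y) -> A x \/ A y.

Lemma principalM a b : principal (a * b) = principal a * principal b.
Proof.
apply: ideal_eqP => [_ [y ->]|].
  by rewrite -mulrA; apply: mem_ideal_mul; [exists 1; rewrite mulr1 | exists y].
apply: ideal_mul_sub => _ _ [x ->] [y ->].
by exists (x * y); rewrite mulrACA.
Qed.

Lemma ideal_neq0P A : reflect (exists2 x, A x & x != 0) (A != 0).
Proof.
apply: (iffP idP) => [A0|[x Ax x0]].
  apply: contrapT => nA; case/eqP: A0; apply: ideal_eqP => [x Ax|_ [y ->]].
    exists 0; rewrite mul0r; apply/eqP; apply: contrapT => /negP x0.
    by apply: nA; exists x.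
  by rewrite mul0r; apply: ideal0.
by apply: contraNneq x0 => A0; move: Ax; rewrite A0 => -[y ->]; rewrite mul0r.
Qed.

Lemma ideal_mul_neq0 A B : A != 0 -> B != 0 -> A * B != 0.
Proof.
move=> /ideal_neq0P[a Aa a0] /ideal_neq0P[b Bb b0]; apply/ideal_neq0P.
by exists (a * b); [apply: mem_ideal_mul | rewrite mulf_neq0].
Qed.

Lemma ideal_one_neq0 : (1 : ideal) != 0.
Proof.
apply/ideal_neq0P; exists 1; last exact: oner_neq0.
by exists 1; rewrite mulr1.
Qed.

End Ideals.

(* The ideal class group, as the monoid of nonzero ideals modulo the relation
   "a A = b B for some nonzero a and b in R". *)
Section ClassGroup.
Variable R : idomainType.

Record nzideal := NzIdeal {
  nzideal_val :> ideal R;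
  nzideal_neq0 : nzideal_val != 0 }.

HB.instance Definition _ := [isSub for nzideal_val].
HB.instance Definition _ := [Choice of nzideal by <:].

Implicit Types A B C : nzideal.

Definition nzideal_one : nzideal := NzIdeal (ideal_one_neq0 R).
Definition nzideal_mul A B : nzideal :=
  NzIdeal (ideal_mul_neq0 (nzideal_neq0 A) (nzideal_neq0 B)).

Definition ideal_equiv : rel nzideal := fun A B =>
  `[< exists a b : R,
      [/\ a != 0, b != 0 &
         principal a * (A : ideal R) = principal b * (B : ideal R)] >].

Fact ideal_equiv_refl : reflexive ideal_equiv.
Proof. by move=> A; apply/asboolP; exists 1, 1; rewrite oner_neq0. Qed.

Fact ideal_equiv_sym : symmetric ideal_equiv.
Proof.
suff sub A B : ideal_equiv A B -> ideal_equiv B A.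
  by move=> A B; apply/idP/idP; apply: sub.
by move=> /asboolP[a [b [a0 b0 ab]]]; apply/asboolP; exists b, a.
Qed.

Fact ideal_equiv_trans : transitive ideal_equiv.
Proof.
move=> B A C /asboolP[a [b [a0 b0 ab]]] /asboolP[c [d [c0 d0 cd]]].
apply/asboolP; exists (c * a), (b * d); split; rewrite ?mulf_neq0 //.
by rewrite !principalM -!mulrA ab mulrCA cd.
Qed.

Canonical ideal_equiv_rel :=
  EquivRel ideal_equiv ideal_equiv_refl ideal_equiv_sym ideal_equiv_trans.

Definition class_group := {eq_quot ideal_equiv_rel}%qT.
HB.instance Definition _ := EqQuotient.on class_group.
HB.instance Definition _ := Choice.on class_group.

Definition ideal_class (A : nzideal) : class_group := (\pi_class_group A)%qT.

Lemma ideal_class_eqP A B :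
  ideal_class A = ideal_class B <->
  exists a b : R,
    [/\ a != 0, b != 0 &
         principal a * (A : ideal R) = principal b * (B : ideal R)].
Proof. by split=> [/eqmodP/asboolP|?]; last exact/eqmodP/asboolP. Qed.

Definition class_one : class_group := ideal_class nzideal_one.
Definition class_mul (x y : class_group) : class_group :=
  ideal_class (nzideal_mul (repr x) (repr y)).

Lemma ideal_classM A B :
  class_mul (ideal_class A) (ideal_class B) = ideal_class (nzideal_mul A B).
Proof.
have /ideal_class_eqP[a [a' [a0 a'0 eA]]] :
  ideal_class (repr (ideal_class A)) = ideal_class A by apply: reprK.
have /ideal_class_eqP[b [b' [b0 b'0 eB]]] :
  ideal_class (repr (ideal_class B)) = ideal_class B by apply: reprK.
apply/ideal_class_eqP; exists (a * b), (a' * b'); split; rewrite ?mulf_neq0 //=.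
by rewrite !principalM mulrACA eA eB mulrACA.
Qed.

Lemma ideal_classK x : ideal_class (repr x) = x.
Proof. exact: reprK. Qed.

Fact class_mulA : associative class_mul.
Proof.
move=> x y z; rewrite -[x]ideal_classK -[y]ideal_classK -[z]ideal_classK.
by rewrite !ideal_classM; congr ideal_class; apply: val_inj; rewrite /= mulrA.
Qed.

Fact class_mul1 : left_id class_one class_mul.
Proof.
move=> x; rewrite -[x]ideal_classK ideal_classM.
by congr ideal_class; apply: val_inj; rewrite /= mul1r.
Qed.

Fact class_mulx1 : right_id class_one class_mul.
Proof.
move=> x; rewrite -[x]ideal_classK ideal_classM.
by congr ideal_class; apply: val_inj; rewrite /= mulr1.
Qed.

HB.instance Definition _ :=
  isMonoid.Build class_group class_mulA class_mul1 class_mulx1.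

End ClassGroup.

(* G = {1, g, ..., g^(h-1)}, without repetition and with g^h = 1: this makes the
   monoid G a cyclic group with exactly h elements, and forces h > 0. *)
Definition cyclic_of_order (G : monoidType) (h : nat) : Prop :=
  exists g : G, (g ^+ h = 1)%g /\ bijective (fun i : 'I_h => (g ^+ i)%g).

Definition number_of_classes (R : idomainType) (m : nat)
    (p : 'I_m -> nzideal R) (t : nat) : Prop :=
  (range (fun i => ideal_class (p i)) #= `I_t)%card.

(* An int: h - 'C(t, 2) may be negative. *)
Definition B_bound (h t : nat) : int :=
  Num.min (h%:Z - t%:Z + 1)
          (Num.max ((h %/ 2)%N%:Z + 1) (h%:Z - 'C(t, 2)%:Z)).

(* Main.v *)
(** A product of primes whose class is trivial is principal, and when it is
    minimal among the nonempty ones a generator is irreducible, so everything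
    reduces to short zero-sum subsequences of a sequence of length at least [h]
    with [t] distinct terms in the cyclic group of order [h].
    - The length [h - t + 1] comes from Scherk's theorem
      [#|X + Y| >= #|X| + #|Y| - 1], valid when [0] is only written as [0 + 0].
    - For [L > h / 2], a zero-sum-free sequence of length [L] has, by a theorem
      of Savchev and Chen, terms [x_i g] with positive integers [x_i] of sum
      less than [h]. If [t] of the [x_i] are distinct, their sum is at least
      [L + 'C(t, 2)], whence [L < h - 'C(t, 2)].
    - When [t = 3] and [h >= 7] the latter bound is [h - 3]; the cases [h = 5]
      and [h = 6] are finite.
    No arithmetic of number fields is involved: since the classes form a group,
    every nonzero ideal is invertible, and factorizations into primes are
    unique. *)
Require Import Defs.
From mathcomp Require Import boolp classical_sets cardinality.
From mathcomp Require Import all_boot all_order all_fingroup all_algebra all_field.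
From mathcomp Require Import zify.
Import Order.TTheory GRing.Theory Num.Theory.
Set Implicit Arguments.
Unset Strict Implicit.
Unset Printing Implicit Defensive.
Local Open Scope ring_scope.

(** * Subset sums of zero-sum-free sequences *)

Section ZeroSums.
Variables (G : finZmodType) (T : finType) (f : T -> G).
Implicit Types (A B J : {set T}) (X Y : {set G}).

Definition zero_sum_free A : Prop :=
  forall J, J \subset A -> J != set0 -> \sum_(i in J) f i != 0.

Definition subset_sums A : {set G} :=
  [set \sum_(i in J) f i | J : {set T} in powerset A].

Lemma subset_sumsP A x :
  reflect (exists2 J : {set T}, J \subset A & x = \sum_(i in J) f i)
          (x \in subset_sums A).
Proof.
apply: (iffP imsetP) => -[J]; first by rewrite powersetE => ? ->; exists J.
by move=> JA ->; exists J; rewrite ?powersetE.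
Qed.

Lemma subset_sums0 A : 0 \in subset_sums A.
Proof. by apply/subset_sumsP; exists set0; rewrite ?sub0set ?big_set0. Qed.

Lemma subset_sumsS A B : A \subset B -> subset_sums A \subset subset_sums B.
Proof.
move=> AB; apply/subsetP=> _ /subset_sumsP[J JA ->]; apply/subset_sumsP.
by exists J => //; apply: subset_trans AB.
Qed.

Lemma subset_sumsD1 A a x : a \in A ->
  (x \in subset_sums A) =
  (x \in subset_sums (A :\ a)) || (x - f a \in subset_sums (A :\ a)).
Proof.
move=> aA; apply/idP/orP => [/subset_sumsP[J JA ->]|[]].
- have [aJ|aJ] := boolP (a \in J).
    right; apply/subset_sumsP; exists (J :\ a); first exact: setSD.
    by rewrite (big_setD1 a) //= addrAC subrr add0r.
  by left; apply/subset_sumsP; exists J; rewrite // subsetD1 JA.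
- exact/subsetP/subset_sumsS/subsetDl.
- case/subset_sumsP=> J; rewrite subsetD1 => /andP[JA aJ] /eqP.
  rewrite subr_eq => /eqP->; apply/subset_sumsP; exists (a |: J).
    by rewrite subUset sub1set aA.
  by rewrite big_setU1 //= addrC.
Qed.

Lemma subset_sums_rev A x :
  x \in subset_sums A -> \sum_(i in A) f i - x \in subset_sums A.
Proof.
case/subset_sumsP=> J JA ->; apply/subset_sumsP; exists (A :\: J).
  exact: subsetDl.
by rewrite (big_setID J) /= (setIidPr JA) addrAC subrr add0r.
Qed.

Lemma zero_sum_freeS A B : A \subset B -> zero_sum_free B -> zero_sum_free A.
Proof. by move=> AB zB J JA; apply: zB; apply: subset_trans AB. Qed.

Lemma zero_sum_free_opp A a : zero_sum_free A -> a \in A ->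
  - f a \notin subset_sums (A :\ a).
Proof.
move=> zA aA; apply/subset_sumsP=> -[J]; rewrite subsetD1 => /andP[JA aJ] E.
have /negP[] : \sum_(i in a |: J) f i != 0.
  by apply: zA; [rewrite subUset sub1set aA | apply/set0Pn; exists a; rewrite setU11].
by rewrite big_setU1 //= -E subrr.
Qed.

(** Complementation inside [A :\ a] would turn the sum over [A] into [- f a], which is not a subset
    sum there. So each term contributes at least one new sum, the total. *)
Lemma zero_sum_free_sum A a : zero_sum_free A -> a \in A ->
  \sum_(i in A) f i \notin subset_sums (A :\ a).
Proof.
move=> zA aA; apply: contra (zero_sum_free_opp zA aA) => /subset_sums_rev.
by rewrite (big_setD1 a aA) /= opprD addrCA subrr addr0.
Qed.

Lemma card_subset_sumsD1 A a : zero_sum_free A -> a \in A ->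
  (#|subset_sums (A :\ a)| < #|subset_sums A|)%N.
Proof.
move=> zA aA; apply: proper_card; apply/properP; split.
  exact/subset_sumsS/subsetDl.
exists (\sum_(i in A) f i); last exact: zero_sum_free_sum.
by apply/subset_sumsP; exists A.
Qed.

Lemma card_subset_sums A : zero_sum_free A -> (#|A| < #|subset_sums A|)%N.
Proof.
have [n] := ubnP #|A|; elim: n A => // n IHn A An zA.
have [->|[a aA]] := set_0Vmem A.
  by rewrite cards0; apply/card_gt0P; exists 0; apply: subset_sums0.
apply: leq_ltn_trans (card_subset_sumsD1 zA aA).
rewrite (cardsD1 a) aA add1n; apply: IHn.
  by move: An; rewrite (cardsD1 a) aA add1n ltnS.
by apply: zero_sum_freeS zA; apply: subsetDl.
Qed.

End ZeroSums.

(** * Scherk's theorem on sumsets *)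

Section Scherk.
Variable G : finZmodType.
Implicit Types X Y : {set G}.

(* Induction on [Y] through Dyson's transform
   [X' = X :|: (a + Y)], [Y' = Y :&: (X - a)], which keeps [#|X| + #|Y|]. *)
Lemma scherk X Y : 0 \in X -> 0 \in Y ->
  (forall x y, x \in X -> y \in Y -> x + y = 0 -> x = 0 /\ y = 0) ->
  (#|X| + #|Y| <= #|[set (x + y)%R | x in X, y in Y]|.+1)%N.
Proof.
have [n] := ubnP #|Y|; elim: n X Y => // n IHn X Y Yn X0 Y0 uniq0.
have [Y1|[y0 /setD1P[y00 y0Y]]] := set_0Vmem (Y :\ 0).
  rewrite (cardsD1 0 Y) Y0 Y1 cards0 addn0 addn1 ltnS; apply: subset_leq_card.
  by apply/subsetP=> x xX; apply/imset2P; exists x 0; rewrite ?addr0.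
(* Otherwise [X] is stable under adding [y0], so it contains every multiple of [y0], in particular
   [- y0], and [- y0 + y0] is a forbidden expression of zero. *)
have [a aX [y yY ayX]] : exists2 a, a \in X & exists2 y, y \in Y & a + y \notin X.
  have [sXY|] := boolP [forall a in X, forall y in Y, a + y \in X]; last first.
    by case/forall_inPn=> a aX /forall_inPn[y yY ayX]; exists a => //; exists y.
  have Xn k : y0 *+ k \in X.
    elim: k => [|k IH]; rewrite ?mulr0n // mulrSr.
    by move/forall_inP: sXY => /(_ _ IH)/forall_inP; apply.
  have y0N : y0 *+ #[y0]%g.-1 + y0 = 0.
    by rewrite -mulrSr prednK ?order_gt0 // -FinRing.zmodXgE expg_order.
  by case: (uniq0 _ _ (Xn _) y0Y y0N) => _ /eqP; rewrite (negPf y00).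
pose X' := X :|: [set a + y | y in Y]; pose Y' := [set y in Y | a + y \in X].
have cX : (#|X'| + #|Y'| = #|X| + #|Y|)%N.
  have <- : #|[set a + y | y in Y] :&: X| = #|Y'|.
    have addI : injective (+%R a) by apply: addrI.
    rewrite -(card_imset (mem Y') addI); apply: eq_card => z; rewrite inE.
    apply/andP/imsetP => [[/imsetP[w wY ->] awX]|[w]].
      by exists w; rewrite // inE wY.
    by rewrite inE => /andP[wY awX] ->; split=> //; apply: imset_f.
  by rewrite /X' setIC cardsUI card_imset //; apply: addrI.
rewrite -cX; apply: leq_trans (IHn X' Y' _ _ _ _) _.
- have YY : (#|Y'| < #|Y|)%N.
    apply: proper_card; apply/properP; split.
      by apply/subsetP=> z; rewrite inE => /andP[].
    by exists y; rewrite // inE yY.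
  exact: leq_trans YY _.
- by rewrite inE X0.
- by rewrite inE Y0 addr0.
(* Both remaining checks rest on the exchange [(a + w) + z = (a + z) + w], where [a + z] lies in [X]
   by definition of [Y']. *)
- move=> x z /setUP[xX|/imsetP[w wY ->]]; rewrite inE => /andP[zY azX].
    exact: uniq0.
  rewrite addrAC => /(uniq0 _ _ azX wY)[az0 ->].
  by have [-> ->] := uniq0 _ _ aX zY az0; rewrite addr0.
- rewrite ltnS; apply/subset_leq_card/subsetP=> _ /imset2P[x z + + ->].
  rewrite !inE => /orP[xX|/imsetP[w wY ->]] /andP[zY azX].
    by apply/imset2P; exists x z.
  by apply/imset2P; exists (a + z) w; rewrite // addrAC.
Qed.

End Scherk.

(** The largest of [#|B|] distinct natural numbers is at least [#|B| - 1]; the induction removes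
    it. *)
Lemma bin2_sum_inj (T : finType) (y : T -> nat) (B : {set T}) :
  {in B &, injective y} -> ('C(#|B|, 2) <= \sum_(i in B) y i)%N.
Proof.
have [n] := ubnP #|B|; elim: n B => // n IHn B Bn yB.
have [->|[b bB]] := set_0Vmem B; first by rewrite cards0.
have [i iB ymax] : exists2 i, i \in B & forall j, j \in B -> (y j <= y i)%N.
  by case: (arg_maxnP y bB) => i iB ?; exists i.
have cB : (#|B| <= (y i).+1)%N.
  rewrite -(card_in_imset (f := fun j => inord (y j) : 'I_(y i).+1)).
    by rewrite -[X in (_ <= X)%N]card_ord max_card.
  move=> j k jB kB /(congr1 val); rewrite /= !inordK ?ltnS ?ymax //.
  exact: yB.
move: Bn cB; rewrite (big_setD1 i) // (cardsD1 i) iB add1n !ltnS => Bn cB.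
rewrite binS bin1 addnC leq_add // IHn //.
by move=> j k /setD1P[_ jB] /setD1P[_ kB]; apply: yB.
Qed.

(** * Structure of long zero-sum-free sequences *)

Section LongZeroSumFree.
Variables (G : finZmodType) (T : finType) (f : T -> G).
Implicit Types (A B : {set T}).

Local Notation zero_sum_free := (zero_sum_free f).
Local Notation subset_sums := (subset_sums f).

(* If every term contributes exactly one new sum, then removing any term loses
   only the total sum [s], so that the set of subset sums is stable under subtracting
   any term from a nonzero sum. For distinct terms [f a] and [f b], it thus
   contains [f b - f a] and then [- f a], which can only be [s]; likewise
   [- f b = s]. *)
Lemma minimal_growth_constant A : zero_sum_free A ->
  (forall a, a \in A -> (#|subset_sums A| <= #|subset_sums (A :\ a)|.+1)%N) ->
  {in A &, forall a b, f a = f b}.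
Proof.
move=> zA growth.
have sA c : c \in A ->
    subset_sums A :\ (\sum_(i in A) f i) = subset_sums (A :\ c).
  move=> cA; apply/esym/eqP; rewrite eqEcard; apply/andP; split.
    rewrite subsetD1 zero_sum_free_sum // andbT.
    exact/subset_sumsS/subsetDl.
  have := growth c cA; rewrite (cardsD1 (\sum_(i in A) f i)).
  suff -> : \sum_(i in A) f i \in subset_sums A by rewrite add1n ltnS.
  by apply/subset_sumsP; exists A.
have sub x c : x \in subset_sums A -> x != 0 -> c \in A ->
    x - f c \in subset_sums A.
  move=> xA x0 cA; rewrite -[x - f c](subKr (\sum_(i in A) f i)).
  apply: subset_sums_rev; rewrite (subset_sumsD1 _ _ cA); apply/orP; right.
  rewrite opprB addrCA addrAC subrr add0r -sA // in_setD1.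
  rewrite subset_sums_rev // andbT; apply: contra x0.
  by rewrite -subr_eq0 addrAC subrr add0r oppr_eq0.
have nz c : c \in A -> f c != 0.
  move=> cA; have := zA [set c]; rewrite sub1set big_set1; apply=> //.
  by apply/set0Pn; exists c; rewrite set11.
have opp a b : a \in A -> b \in A -> f a != f b -> - f a = \sum_(i in A) f i.
  move=> aA bA fab; apply/eqP; apply: contraNT (zero_sum_free_opp zA aA).
  rewrite -sA // in_setD1 => -> /=.
  suff: f b - f a - f b \in subset_sums A by rewrite addrAC subrr add0r.
  have bS : f b \in subset_sums A.
    by apply/subset_sumsP; exists [set b]; rewrite ?sub1set ?big_set1.
  by rewrite !sub ?nz // subr_eq0 eq_sym.
move=> a b aA bA; apply/eqP; apply: contraT => fab.
case/eqP: (fab); apply: oppr_inj.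
by rewrite (opp a b) // (opp b a) // eq_sym.
Qed.


(** Induction on [#|A|]. If no removal loses more than one sum, all terms equal some [g]. Otherwise
    removing some [a] loses at least two, so [A :\ a] still satisfies the size hypothesis and its
    sums are [0, g, ..., X g]; then [f a] is itself one of these multiples. *)
Lemma savchev_chen A : zero_sum_free A ->
  (#|subset_sums A| < #|A|.*2)%N ->
  exists g (x : T -> nat),
    [/\ {in A, forall i, (0 < x i)%N /\ f i = g *+ x i},
        subset_sums A = [set g *+ k | k : 'I_(\sum_(i in A) x i).+1] &
        #|subset_sums A| = (\sum_(i in A) x i).+1].
Proof.
have [n] := ubnP #|A|; elim: n A => // n IHn A An zA small.
have [a0 a0A] : exists a, a \in A.
  apply/set0Pn; apply: contraTneq small => ->.
  by rewrite cards0 double0.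
have [|] := boolP [forall a in A, (#|subset_sums A| <= #|subset_sums (A :\ a)|.+1)%N].
  move=> /forall_inP /(minimal_growth_constant zA) fA.
  exists (f a0), (fun=> 1%N); rewrite sum1_card.
  have sumE (J : {set T}) : J \subset A -> \sum_(i in J) f i = f a0 *+ #|J|.
    move=> JA; rewrite (eq_bigr (fun=> f a0)) ?sumr_const //.
    by move=> i /(subsetP JA) iA; apply: fA.
  have cA : subset_sums A = [set f a0 *+ k | k : 'I_#|A|.+1].
    apply/setP=> y; apply/subset_sumsP/imsetP=> [[J JA ->]|[k _ ->]].
      exists (inord #|J|) => //.
      by rewrite inordK ?ltnS ?subset_leq_card // sumE.
    have /card_geqP[s [us sk sA]] : (k <= #|A|)%N by rewrite -ltnS.
    have JA : [set i in s] \subset A by apply/subsetP=> i; rewrite inE => /sA.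
    exists [set i in s] => //; rewrite sumE //.
    by rewrite cardsE (card_uniqP us) sk.
  split=> //; first by move=> i iA; rewrite mulr1n; split=> //; apply: fA.
  apply/eqP; rewrite eqn_leq card_subset_sums // andbT cA.
  by apply: leq_trans (leq_imset_card _ _) _; rewrite card_ord.
case/forall_inPn=> a aA; rewrite -ltnNge => growth.
have AE : #|A| = #|A :\ a|.+1 by rewrite (cardsD1 a) aA.
have zA' : zero_sum_free (A :\ a).
  by apply: zero_sum_freeS zA; apply: subsetDl.
have [|//||g [x [xA sums card_sums]]] := IHn (A :\ a).
- by rewrite -ltnS -AE.
- by move: small growth; rewrite AE; lia.
set X := (\sum_(i in A :\ a) x i)%N in sums card_sums.
have AX : (#|A :\ a| <= X)%N.
  by rewrite -sum1_card; apply: leq_sum => i /xA[].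
have mem_sums k : (k <= X)%N -> g *+ k \in subset_sums (A :\ a).
  by rewrite -ltnS => kX; rewrite sums; apply/imsetP; exists (Ordinal kX).
have inj_sums : {in 'I_X.+1 &, injective (fun k : 'I_X.+1 => g *+ k)}.
  apply/imset_injP; rewrite -sums card_sums card_ord //.
have gX k : (0 < k <= X)%N -> g *+ k != 0.
  case/andP=> k0 kX; apply/eqP=> E.
  have := @inj_sums (inord k) ord0; rewrite !inE /= mulr0n inordK // E.
  by move=> /(_ isT isT erefl)/(congr1 val) /=; rewrite inordK // => /eqP; lia.
(* Two translates of [subset_sums (A :\ a)] are too large to be disjoint. *)
have [y yX fa] : exists2 y, (0 < y <= X)%N & f a = g *+ y.
  have : [set z + f a | z in subset_sums (A :\ a)] :&: subset_sums (A :\ a) != set0.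
    apply: contraTneq small => E; rewrite -leqNgt.
    have <- : #|[set z + f a | z in subset_sums (A :\ a)] :|: subset_sums (A :\ a)| =
              #|subset_sums A|.
      apply: eq_card => z; rewrite inE (subset_sumsD1 _ _ aA) orbC; congr orb.
      apply/imsetP/idP => [[w wA ->]|zA0]; first by rewrite addrK.
      by exists (z - f a); rewrite ?subrK.
    rewrite cardsU E cards0 subn0 card_imset; last exact: addIr.
    by rewrite card_sums AE; lia.
  case/set0Pn=> _ /setIP[/imsetP[z + ->]].
  rewrite {1 2}sums => /imsetP[i _ ->] /imsetP[j _ E].
  (* A common element gives [i g + f a = j g]. If [j <= i], then [- f a] would be a subset sum of
     [A :\ a], against zero-sum-freeness. *)
  have [ij|ji] := ltnP i j.
    exists (j - i)%N; first by have := ltn_ord j; lia.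
    by rewrite mulrnBr ?(ltnW ij) // -E addrAC subrr add0r.
  have /negP[] := zero_sum_free_opp zA aA.
  suff -> : - f a = g *+ (i - j) by apply: mem_sums; have := ltn_ord i; lia.
  by rewrite mulrnBr // -E opprD addrA subrr sub0r.
exists g, (fun i => if i == a then y else x i).
have -> : (\sum_(i in A) (if i == a then y else x i) = y + X)%N.
  rewrite (big_setD1 a) //= eqxx; congr addn; apply: eq_bigr => i.
  by case/setD1P=> /negPf->.
(* As [y <= X], the intervals from [0] to [X] and from [y] to [y + X] overlap and leave no gap. *)
have sumsA : subset_sums A = [set g *+ k | k : 'I_(y + X).+1].
  apply/setP=> z; rewrite (subset_sumsD1 _ _ aA).
  apply/orP/imsetP=> [[]|[k _ ->]].
  - rewrite sums => /imsetP[k _ ->]; exists (inord k) => //.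
    by rewrite inordK //; have := ltn_ord k; lia.
  - rewrite sums => /imsetP[k _ E]; exists (inord (y + k)) => //.
    rewrite inordK; last by have := ltn_ord k; lia.
    by rewrite mulrnDr -fa -E addrC subrK.
  - have [kX|Xk] := leqP k X; [by left; apply: mem_sums | right].
    rewrite fa -mulrnBr; last by lia.
    by apply: mem_sums; have := ltn_ord k; lia.
split=> //.
- move=> i iA; have [->|ia] := eqVneq i a; first by case/andP: yX.
  by apply: xA; rewrite !inE ia.
rewrite sumsA card_in_imset ?card_ord // => i j _ _.
(* If [k g = 0] with [k > X], then [- f a = (k - y) g] is a subset sum of [A :\ a], which is
   excluded. *)
have gyX k : (0 < k <= y + X)%N -> g *+ k != 0.
  move=> k0; have [kX|Xk] := leqP k X; first by apply: gX; lia.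
  apply: contraNneq (zero_sum_free_opp zA aA) => E.
  suff -> : - f a = g *+ (k - y) by apply: mem_sums; lia.
  by rewrite mulrnBr; [rewrite E sub0r fa | lia].
wlog ij : i j / (i <= j)%N => [W|].
  by have [/W//|/ltnW/W W'] := leqP i j; move=> /esym/W'.
move=> /esym/eqP; rewrite -subr_eq0 -mulrnBr // => E.
apply/val_inj/eqP; rewrite eqn_leq ij /= leqNgt; apply: contraTN E => lt_ij.
by apply: gyX; have := ltn_ord j; lia.
Qed.

End LongZeroSumFree.

(** * Two sources of short zero sums *)

Lemma card_superset (T : finType) (B : {set T}) k :
  (#|B| <= k <= #|T|)%N -> exists2 U : {set T}, B \subset U & #|U| = k.
Proof.
case/andP=> Bk kT.
have /card_geqP[s [us sk sB]] : (k - #|B| <= #|~: B|)%N.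
  by have := cardsC B; lia.
exists (B :|: [set i in s]); first exact: subsetUl.
have -> : #|B :|: [set i in s]| = (#|B| + #|[set i in s]|)%N.
  apply/eqP; rewrite (leq_card_setU B _) -setI_eq0; apply/eqP/setP=> i.
  by rewrite !inE; apply/negP=> /andP[iB /sB]; rewrite inE iB.
by rewrite cardsE (card_uniqP us) sk subnKC.
Qed.

Section ShortZeroSums.
Variables (G : finZmodType) (T : finType) (f : T -> G).
Implicit Types (B J : {set T}) (L : nat).

Definition short_zero_sum L : Prop :=
  exists J, [/\ J != set0, (#|J| <= L)%N & \sum_(i in J) f i = 0].

Lemma short_zero_sumP L : short_zero_sum L \/
  forall J, (#|J| <= L)%N -> J != set0 -> \sum_(i in J) f i != 0.
Proof.
have [/existsP[J /and3P[J0 JL /eqP fJ]]|no] := boolP [exists J : {set T},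
    [&& J != set0, (#|J| <= L)%N & \sum_(i in J) f i == 0]].
  by left; exists J.
right=> J JL J0; apply: contra no => fJ; apply/existsP; exists J.
by rewrite J0 JL.
Qed.

(* Scherk's theorem is applied to the subset sums of the terms outside [B] and
   to the set formed by [0] and the terms in [B]. *)
Lemma short_zero_sum_scherk B : {in B &, injective f} -> (#|G| <= #|T|)%N ->
  short_zero_sum (#|G| - #|B|).+1.
Proof.
move=> fB GT; have BG : (#|B| <= #|G|)%N.
  by rewrite -(card_in_imset fB) max_card.
have [//|no] := short_zero_sumP (#|G| - #|B|).+1.
(* With [U] of size exactly [#|G|], a zero sum using terms of [U] outside [B] and at most one term
   of [B] has the required length. *)
have [|U BU cU] := @card_superset _ B #|G|; first by rewrite BG.
have cR : #|U :\: B| = (#|G| - #|B|)%N.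
  by rewrite cardsD (setIidPr BU) cU.
have zR : zero_sum_free f (U :\: B).
  by move=> J /subset_leq_card JR; apply: no; lia.
have fB0 : 0 \notin f @: B.
  apply/imsetP=> -[b bB E]; apply: (elimN eqP (no [set b] _ _)).
  - by rewrite cards1.
  - by apply/set0Pn; exists b; rewrite set11.
  - by rewrite big_set1 -E.
have cC : #|0 |: f @: B| = #|B|.+1 by rewrite cardsU1 fB0 card_in_imset.
have := card_subset_sums zR.
have := scherk (subset_sums0 f (U :\: B)) (setU11 0 (f @: B)).
rewrite cC cR => sch cS.
suff uniq0 : forall x y, x \in subset_sums f (U :\: B) -> y \in 0 |: f @: B ->
    x + y = 0 -> x = 0 /\ y = 0.
  (* The two sets have at least [#|G| - #|B| + 1] and [#|B| + 1] elements, so their sumset would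
     have at least [#|G| + 1]. *)
  by have := leq_trans (sch uniq0) (max_card _ : (_ < #|G|.+1)%N); lia.
move=> x y xS /setU1P[->|/imsetP[b bB ->]]; first by rewrite addr0.
case/subset_sumsP: xS => J JR -> E.
have bJ : b \notin J by apply/negP=> /(subsetP JR); rewrite !inE bB.
exfalso; apply: (elimN eqP (no (b |: J) _ _)).
- by rewrite cardsU1 bJ; have := subset_leq_card JR; lia.
- by apply/set0Pn; exists b; rewrite setU11.
- by rewrite big_setU1 //= addrC E.
Qed.

(* In a long zero-sum-free sequence the terms are [g *+ x i] with
   [\sum x i < #|G|], but distinct terms have distinct [x i]. *)
Lemma short_zero_sum_savchev_chen B L : {in B &, injective f} ->
  (#|G| < L.*2)%N -> (#|B| <= L <= #|T|)%N -> (#|G| <= L + 'C(#|B|, 2))%N ->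
  short_zero_sum L.
Proof.
move=> fB GL BL GB; have [//|no] := short_zero_sumP L.
have [U BU cU] := card_superset BL.
have zU : zero_sum_free f U.
  by move=> J /subset_leq_card JU; apply: no; rewrite -cU.
have [|g [x [xU _ cx]]] := savchev_chen zU.
  by rewrite cU; apply: leq_ltn_trans GL; apply: max_card.
(* The [x i] are positive, so the distinct numbers [x i - 1] can be compared with [0, 1, 2, ...].
   The total of the [x i] is then at least [L + 'C(#|B|, 2)], too many sums for [G]. *)
have xB : ('C(#|B|, 2) <= \sum_(i in B) (x i).-1)%N.
  apply: bin2_sum_inj => i j iB jB E; apply: fB => //.
  have [[xi ->] [xj ->]] := (xU _ (subsetP BU _ iB), xU _ (subsetP BU _ jB)).
  by congr (g *+ _); lia.
have sU : (\sum_(i in U) x i = #|U| + \sum_(i in U) (x i).-1)%N.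
  rewrite -sum1_card -big_split /=; apply: eq_bigr => i /xU[]; lia.
have : (\sum_(i in B) (x i).-1 <= \sum_(i in U) (x i).-1)%N.
  by rewrite [X in (_ <= X)%N](big_setID B) /= (setIidPr BU) leq_addr.
have : (#|subset_sums f U| <= #|G|)%N by apply: max_card.
by rewrite cx sU cU; lia.
Qed.

Lemma short_zero_sum_mask (s : seq T) m L : uniq s ->
  (0 < size (mask m s) <= L)%N -> \sum_(i <- mask m s) f i = 0 ->
  short_zero_sum L.
Proof.
move=> us /andP[m0 mL] E; exists [set i in mask m s].
have um : uniq (mask m s) by apply: mask_uniq.
rewrite cardsE (card_uniqP um) mL; split=> //.
  by rewrite -card_gt0 cardsE (card_uniqP um).
by rewrite (eq_bigl (mem (mask m s))) => [|i]; rewrite ?inE // -big_uniq.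
Qed.

End ShortZeroSums.

(** * Finite verification modulo 5 and 6 *)

Definition masks (k : nat) : seq bitseq :=
  iter k (fun ms => [seq true :: m | m <- ms] ++ [seq false :: m | m <- ms])
       [:: [::]].

(** Residues are represented by natural numbers so that the test can be run by computation. *)
Definition short_zero_sumb (n L : nat) (v : seq nat) : bool :=
  has (fun m => (0 < size (mask m v) <= L)%N && (n %| sumn (mask m v))%N)
      (masks (size v)).

Lemma short_zero_sum_Zp n N L (T : finType) (f : T -> 'I_n.+1) (s : seq T) :
  uniq s -> n.+1 = N -> short_zero_sumb N L [seq val (f i) | i <- s] ->
  short_zero_sum f L.
Proof.
move=> us <- /hasP[m _]; rewrite -map_mask size_map => /andP[mL sum0].
apply: short_zero_sum_mask us mL _; apply/val_inj => /=.
move: sum0 => /eqP <-; elim: (mask m s) => [|i r IHr]; first by rewrite big_nil mod0n.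
by rewrite big_cons /= IHr modnDmr.
Qed.

(** The length [5 - 3 = 2] does not exceed [5 / 2], so the structure theorem does not apply. But the
    nonzero residues form two opposite pairs, so three distinct residues include [0] or a whole
    pair. *)
Lemma short_zero_sumb5 :
  all (fun a => all (fun b => all (fun c =>
    [|| a == b, a == c, b == c | short_zero_sumb 5 2 [:: a; b; c]])
  (iota 0 5)) (iota 0 5)) (iota 0 5).
Proof. by vm_compute. Qed.

(** Three distinct residues need not suffice, as [1, 3, 4] shows. The [if] restricts the inner loops
    over three further terms to such triples. *)
Lemma short_zero_sumb6 :
  all (fun a => all (fun b => all (fun c =>
    if [|| a == b, a == c, b == c | short_zero_sumb 6 3 [:: a; b; c]] then true
    else all (fun d => all (fun e => all (fun g =>
      short_zero_sumb 6 3 [:: a; b; c; d; e; g])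
    (iota 0 6)) (iota 0 6)) (iota 0 6))
  (iota 0 6)) (iota 0 6)) (iota 0 6).
Proof. by vm_compute. Qed.

Lemma short_zero_sum5 n (T : finType) (f : T -> 'I_n.+1) (B : {set T}) :
  n.+1 = 5%N -> {in B &, injective f} -> #|B| = 3%N -> short_zero_sum f 2.
Proof.
move=> n5 fB cB; have fI i : val (f i) \in iota 0 5.
  by rewrite mem_iota -n5 ltn_ord.
have : uniq [seq val (f i) | i <- enum B].
  rewrite map_inj_in_uniq ?enum_uniq // => i j.
  by rewrite !mem_enum => iB jB /val_inj/(fB _ _ iB jB).
move: (enum_uniq B) (cB); rewrite cardE.
case: (enum B) => [|a [|b [|c [|]]]] //= us _.
rewrite !inE negb_or -!andbA => /and4P[/negPf ab /negPf ac /negPf bc _].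
apply: (@short_zero_sum_Zp _ _ _ _ _ [:: a; b; c] us n5).
have := allP (allP (allP short_zero_sumb5 _ (fI a)) _ (fI b)) _ (fI c).
by rewrite ab ac bc.
Qed.

Lemma short_zero_sum6 n (T : finType) (f : T -> 'I_n.+1) (B : {set T}) :
  n.+1 = 6%N -> {in B &, injective f} -> #|B| = 3%N ->
  (6 <= #|T|)%N -> short_zero_sum f 3.
Proof.
move=> n6 fB cB T6; have fI i : val (f i) \in iota 0 6.
  by rewrite mem_iota -n6 ltn_ord.
have [|U BU cU] := @card_superset _ B 6; first by rewrite cB.
have : uniq [seq val (f i) | i <- enum B].
  rewrite map_inj_in_uniq ?enum_uniq // => i j.
  by rewrite !mem_enum => iB jB /val_inj/(fB _ _ iB jB).
have : uniq (enum B ++ enum (U :\: B)).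
  rewrite cat_uniq !enum_uniq andbT /=; apply/hasPn=> i.
  by rewrite !mem_enum => /setDP[].
have : size (enum (U :\: B)) = 3%N.
  by rewrite -cardE cardsD (setIidPr BU) cU cB.
move: (cB); rewrite cardE.
case: (enum B) => [|a [|b [|c [|]]]] //= _.
case: (enum (U :\: B)) => [|d [|e [|g [|]]]] //= _ us.
rewrite !inE negb_or -!andbA => /and4P[/negPf ab /negPf ac /negPf bc _].
have := allP (allP (allP short_zero_sumb6 _ (fI a)) _ (fI b)) _ (fI c).
rewrite ab ac bc; case: ifP => [short _|_ all3].
  apply: (@short_zero_sum_Zp _ _ _ _ _ [:: a; b; c] _ n6) short.
  apply: (@subseq_uniq _ _ [:: a; b; c; d; e; g]) us.
  exact: (prefix_subseq [:: a; b; c]).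
apply: (@short_zero_sum_Zp _ _ _ _ _ [:: a; b; c; d; e; g] us n6).
exact: allP (allP (allP all3 _ (fI d)) _ (fI e)) _ (fI g).
Qed.

(** * The bounds for cyclic groups *)

Lemma short_zero_sum_bound (n : nat) (T : finType) (f : T -> 'I_n.+1)
    (B : {set T}) : {in B &, injective f} -> (n < #|T|)%N ->
  exists2 L, short_zero_sum f L & L%:Z <= B_bound n.+1 #|B|.
Proof.
move=> fB nT; have cG : #|'I_n.+1| = n.+1 by rewrite card_ord.
have Bn : (#|B| <= n.+1)%N by rewrite -[leqRHS]cG -(card_in_imset fB) max_card.
have := short_zero_sum_scherk fB; rewrite cG => /(_ nT) scherkB.
pose L2 := maxn (n.+1 %/ 2).+1 (n.+1 - 'C(#|B|, 2)).
(* If the distinct terms do not fit into a sequence of length [L2], then [#|B| > L2 > h / 2] with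
   [h = n.+1], and Scherk's length [h - #|B| + 1] is the smaller one. *)
have [BL|LB] := leqP #|B| L2; last first.
  exists (n.+1 - #|B|).+1 => //; rewrite /B_bound.
  by move: LB; rewrite /L2; lia.
have sc : short_zero_sum f L2.
  apply: short_zero_sum_savchev_chen fB _ _ _; rewrite ?cG ?BL /L2; lia.
have [le|le] := leqP (n.+1 - #|B|).+1 L2.
  by exists (n.+1 - #|B|).+1 => //; rewrite /B_bound; move: le; rewrite /L2; lia.
by exists L2 => //; rewrite /B_bound; move: le; rewrite /L2; lia.
Qed.

Lemma short_zero_sum_three (n : nat) (T : finType) (f : T -> 'I_n.+1)
    (B : {set T}) : {in B &, injective f} -> (n < #|T|)%N ->
  #|B| = 3%N -> (4 <= n)%N -> short_zero_sum f (n - 2).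
Proof.
move=> fB nT cB; case: (ltnP 5 n) => [n5 _|].
  (* Here [n - 2] is [h - 3] with [h = n.+1]; the condition [2 (h - 3) > h] holds from [h = 7]
     on. *)
  by apply: short_zero_sum_savchev_chen fB _ _ _; rewrite ?cB ?card_ord ?bin2; lia.
move=> n5 n4; have [E|E] : n = 4%N \/ n = 5%N by lia.
  by rewrite [(n - 2)%N](_ : _ = 2%N); [apply: short_zero_sum5 fB cB; lia | lia].
rewrite [(n - 2)%N](_ : _ = 3%N); last by lia.
by apply: short_zero_sum6 fB cB _; lia.
Qed.

(** * Ideal arithmetic over a domain with cyclic class group *)

Section CyclicClassGroup.
Variables (R : idomainType) (h : nat).
Hypothesis cyclic_class_group : cyclic_of_order (class_group R) h.
Implicit Types (A B P X Y : ideal R) (a b c x y : R).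

Lemma ideal_ext A B : (forall x, A x <-> B x) -> A = B.
Proof. by move=> AB; apply: ideal_eqP => x /AB. Qed.

Lemma mem_principal_mul a A x :
  (principal a * A)%R x <-> exists2 y, A y & x = a * y.
Proof.
split=> [|[y Ay ->]]; last first.
  by apply: mem_ideal_mul => //; exists 1; rewrite mulr1.
case=> s sA ->; rewrite big_seq; elim/big_ind: _.
- by exists 0; rewrite ?mulr0 //; apply: ideal0.
- by move=> _ _ [y Ay ->] [z Az ->]; exists (y + z); rewrite ?mulrDr //; apply: idealD.
- by case=> u v /sA[[y /= ->] Av]; exists (y * v); rewrite ?mulrA //; apply: idealM.
Qed.

Lemma principal_mulI a : a != 0 -> injective (fun A => principal a * A).
Proof.
move=> a0; suff sub A B : principal a * A = principal a * B -> forall x, A x -> B x.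
  by move=> A B E; apply: ideal_eqP; apply: sub.
move=> E x Ax; suff /mem_principal_mul[y By /(mulfI a0)->] : (principal a * B)%R (a * x) by [].
by rewrite -E; apply/mem_principal_mul; exists x.
Qed.

Lemma ideal1 A : A 1 -> A = 1.
Proof.
move=> A1; apply: ideal_ext => x; split=> _.
  by exists x; rewrite mul1r.
by rewrite -[x]mulr1; apply: idealM.
Qed.

Lemma ideal_mul1l A B : A * B = 1 -> A = 1.
Proof.
move=> AB; apply: ideal1.
have : (A * B)%R 1 by rewrite AB; exists 1; rewrite mulr1.
by apply: ideal_mul_sub => a b Aa _; rewrite mulrC; apply: idealM.
Qed.

Lemma principal_unit a : principal a = 1 -> a \is a GRing.unit.
Proof.
move=> E; have [y Ey] : principal a 1 by rewrite E; exists 1; rewrite mulr1.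
by apply/unitrPr; exists y.
Qed.

(** From [a A = (b)] one gets [b = a c] with [c] in [A]; cancelling [a] leaves [A = (c)]. *)
Lemma class_one_principal (A : nzideal R) :
  ideal_class A = class_one R -> exists a, (A : ideal R) = principal a.
Proof.
case/ideal_class_eqP=> a [b [a0 b0]].
rewrite [_ * (nzideal_one R : ideal R)]mulr1 => E.
have [c _ Eb] : exists2 c, (A : ideal R) c & b = a * c.
  by apply/mem_principal_mul; rewrite E; exists 1; rewrite mulr1.
exists c; apply: (principal_mulI a0) => /=.
by rewrite E -principalM -Eb.
Qed.

(** If [A] has class [g ^ k], any [B] of class [g ^ (h - k)] makes [A B] principal. *)
Lemma ideal_invertible A : A != 0 -> exists B c, c != 0 /\ A * B = principal c.
Proof.
move=> A0; pose A' := NzIdeal A0.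
have [g [gh [log gK logK]]] := cyclic_class_group.
have := ltn_ord (log (ideal_class A')) => lt_h.
have [B cB] : exists B : nzideal R, ideal_class B = (g ^+ (h - log (ideal_class A')))%g.
  by eexists; apply: ideal_classK.
exists (B : ideal R).
have [c Ec] : exists c, (nzideal_mul A' B : ideal R) = principal c.
  apply: class_one_principal; rewrite -ideal_classM cB.
  rewrite -{1}[ideal_class A']logK; apply: etrans (esym (expgnDr _ _ _)) _.
  by rewrite subnKC ?gh // ltnW.
exists c; split=> //; apply: contraTneq (nzideal_neq0 (nzideal_mul A' B)) => c0.
by rewrite Ec c0 eqxx.
Qed.

Lemma ideal_mulI A : A != 0 -> injective (fun X => A * X).
Proof.
move=> /ideal_invertible[B [c [c0 AB]]] X Y /= E; apply: (principal_mulI c0).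
by rewrite /= -AB mulrAC E mulrAC.
Qed.

(* To contain is to divide. *)
Lemma ideal_dvd A P : P != 0 -> (forall x, A x -> P x) -> exists C, A = P * C.
Proof.
move=> P0 AP; have [Q [c [c0 PQ]]] := ideal_invertible P0.
have AQ x : (A * Q)%R x -> exists y, x = c * y.
  move: x; apply: (@ideal_mul_sub _ A Q (principal c)) => a b /AP Pa Qb.
  by rewrite -PQ; apply: mem_ideal_mul.
(* The quotient is the fractional ideal [c^-1 A Q], encoded as the set of [x] with [c x] in [A Q];
   it consists of elements of [R] because [A Q] is contained in [(c)]. *)
have C0 : (A * Q)%R (c * 0) by rewrite mulr0; apply: ideal0.
have CD x y : (A * Q)%R (c * x) -> (A * Q)%R (c * y) -> (A * Q)%R (c * (x + y)).
  by rewrite mulrDr; apply: idealD.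
have CM a x : (A * Q)%R (c * x) -> (A * Q)%R (c * (a * x)).
  by rewrite mulrCA; apply: idealM.
exists (@Ideal R (fun x => (A * Q)%R (c * x)) C0 CD CM).
apply: (principal_mulI c0) => /=; rewrite mulrCA.
have <- : A * Q = principal c * @Ideal R (fun x => (A * Q)%R (c * x)) C0 CD CM.
  apply: ideal_ext => x; rewrite mem_principal_mul; split=> [AQx|[y ? ->]//].
  by have [y Ey] := AQ _ AQx; exists y; rewrite //= -Ey.
by rewrite mulrCA PQ mulrC.
Qed.

Lemma prime_ideal_mul P A B : prime_ideal P -> (forall x, (A * B)%R x -> P x) ->
  (forall x, A x -> P x) \/ (forall x, B x -> P x).
Proof.
move=> [_ prP] AB; have [|nA] := pselect (forall x, A x -> P x); first by left.
right=> y By; apply: contrapT => nPy; apply: nA => x Ax.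
by have [|//|/nPy] := prP x y; first exact/AB/mem_ideal_mul.
Qed.

(** * Factorization of products of primes *)

Section PrimeProducts.
Variables (T : finType) (p : T -> nzideal R).
Hypothesis prime_p : forall i, prime_ideal (p i).
Implicit Types I J : {set T}.

(** A prime [p i] of the product contains [A] or [B], hence divides it, and can be cancelled.
    Factors are recorded by index, which keeps repeated primes apart. *)
Lemma prime_factorization_mul I A B :
  A * B = \prod_(i in I) (p i : ideal R) ->
  exists2 J : {set T}, J \subset I &
    A = \prod_(i in J) (p i : ideal R) /\
    B = \prod_(i in I :\: J) (p i : ideal R).
Proof.
have [n] := ubnP #|I|; elim: n I A B => // n IHn I A B In AB.
have [I0|[i iI]] := set_0Vmem I.
  move: AB; rewrite I0 big_set0 => AB; exists set0; rewrite ?sub0set // setD0.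
  by rewrite !big_set0 (ideal_mul1l AB) (@ideal_mul1l B A) // mulrC.
have {In} In : (#|I :\ i| < n)%N by move: In; rewrite (cardsD1 i) iI.
rewrite (big_setD1 i) //= in AB.
have step X Y : X * Y = (p i : ideal R) * \prod_(j in I :\ i) (p j : ideal R) ->
    (forall x, X x -> p i x) ->
  exists2 J : {set T}, (i \notin J) && (J \subset I) &
    X = \prod_(j in i |: J) (p j : ideal R) /\
    Y = \prod_(j in I :\: (i |: J)) (p j : ideal R).
  move=> XY /(ideal_dvd (nzideal_neq0 (p i)))[C XC].
  move: XY; rewrite XC -mulrA => /(ideal_mulI (nzideal_neq0 (p i))) CY.
  have [J] := IHn _ _ _ In CY; rewrite subsetD1 => /andP[JI iJ] [-> ->].
  exists J; first by rewrite iJ.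
  by rewrite big_setU1 //= setDDl.
have sub x : (A * B)%R x -> p i x.
  rewrite AB; apply: ideal_mul_sub => {}x y px _.
  by rewrite mulrC; apply: idealM.
have [Ap|Bp] := prime_ideal_mul (prime_p i) sub.
  have [J /andP[_ JI] EJ] := step _ _ AB Ap; exists (i |: J) => //.
  by rewrite subUset sub1set iI.
(* With the roles exchanged, the set found collects the primes of [B]; its complement in [I] serves
   for [A]. *)
have [|J /andP[_ JI] [-> ->]] := step B A _ Bp; first by rewrite mulrC.
exists (I :\: (i |: J)); first exact: subsetDl.
by rewrite setDDr setDv set0U (setIidPr _) // subUset sub1set iI.
Qed.

(** Take [J] minimal with principal product [(x)]. A factorization [x = a b] splits [J], and the
    part giving [(a)] is empty or all of [J], so [a] or [b] is a unit. *)
Lemma irreducible_minimal_product I : I != set0 ->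
  (exists a, \prod_(i in I) (p i : ideal R) = principal a) ->
  exists2 J : {set T}, (J != set0) && (J \subset I) &
    exists2 x, irreducible_elt x & \prod_(i in J) (p i : ideal R) = principal x.
Proof.
move=> I0 aI; pose princ J :=
  (J != set0) && `[< exists a, \prod_(i in J) (p i : ideal R) = principal a >].
have /minset_exists[J /minsetP[/andP[J0 /asboolP[x Ex]] minJ] JI] : princ I.
  by rewrite /princ I0; apply/asboolP.
exists J; first by rewrite J0.
have [i iJ] := set0Pn _ J0.
exists x => //; split.
- apply: contraTneq (ideal_one_neq0 R) => x0.
  have : \prod_(i in J) (p i : ideal R) != 0.
    elim/big_ind: _ => [|X Y|j _]; first exact: ideal_one_neq0.
      exact: ideal_mul_neq0.
    exact: nzideal_neq0.
  by rewrite Ex x0 eqxx.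
- apply/negP=> /unitrPr[y xy].
  have : principal x 1 by exists y.
  rewrite -Ex (big_setD1 i) //= => p1; have [np1 _] := prime_p i; apply: np1.
  move: p1; apply: (@ideal_mul_sub _ _ _ (p i)) => a b pa _.
  by rewrite mulrC; apply: idealM.
- move=> a b xab; have := esym Ex; rewrite xab principalM.
  case/prime_factorization_mul=> J' J'J [Ea Eb].
  have [J'0|J'0] := eqVneq J' set0.
    by left; apply: principal_unit; rewrite Ea J'0 big_set0.
  right; apply: principal_unit; rewrite Eb.
  rewrite (minJ J') ?setDv ?big_set0 // /princ J'0 /=.
  by apply/asboolP; exists a.
Qed.

End PrimeProducts.

End CyclicClassGroup.

(** * From ideal classes to exponents modulo [h] *)

Lemma class_prod (R : idomainType) (T : finType) (p : T -> nzideal R)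
    (g : class_group R) (e : T -> nat) (s : seq T) :
  (forall i, ideal_class (p i) = (g ^+ e i)%g) ->
  exists2 A : nzideal R, (A : ideal R) = \prod_(i <- s) (p i : ideal R) &
    ideal_class A = (g ^+ (\sum_(i <- s) e i)%N)%g.
Proof.
move=> ge; elim: s => [|i s [A EA cA]].
  by exists (nzideal_one R); rewrite !big_nil.
exists (nzideal_mul (p i) A); first by rewrite big_cons -EA.
by rewrite big_cons expgnDr -ge -cA; apply/esym/ideal_classM.
Qed.

(** Choosing one index per class turns the count [t] into the size of a set of indices with distinct
    terms, the form used for zero sums. *)
Lemma number_of_classes_transversal (R : idomainType) m (p : 'I_m -> nzideal R) t :
  number_of_classes p t ->
  exists2 B : {set 'I_m}, #|B| = t & {in B &, injective (fun i => ideal_class (p i))}.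
Proof.
rewrite /number_of_classes card_eq_sym => /card_bijP[phi [phi' phiK _]].
have idxP (k : 'I_t) : exists i,
    ideal_class (p i) = val (phi (SigSub (mem_set (ltn_ord k : `I_t%classic k)))).
  set q := phi _.
  by case: (set_mem (valP q)) => i _ <-; exists i.
have [idx idxE] := boolp.choice idxP.
have cI : injective (fun k => ideal_class (p (idx k))).
  move=> k l; rewrite !idxE => /val_inj/(can_inj phiK)/(congr1 val) /=.
  exact: val_inj.
exists [set idx k | k : 'I_t].
  by rewrite card_imset ?card_ord // => k l E; apply: cI; rewrite /= E.
by move=> _ _ /imsetP[k _ ->] /imsetP[l _ ->] /cI->.
Qed.

Theorem proposition5p2 (K : fieldExtType rat) (h m t : nat)
    (p : 'I_m -> nzideal (ring_of_integers K)) :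
  cyclic_of_order (class_group (ring_of_integers K)) h ->
  (forall i : 'I_m, prime_ideal (p i)) ->
  (h <= m)%N ->
  number_of_classes p t ->
  (exists I : {set 'I_m},
     [/\ I != set0,
         #|I|%:Z <= B_bound h t &
         exists2 x : ring_of_integers K, irreducible_elt x &
           \prod_(i in I) (p i : ideal (ring_of_integers K)) = principal x]) /\
  ((5 <= h)%N -> t = 3%N ->
   exists I : {set 'I_m},
     [/\ I != set0,
         #|I|%:Z <= h%:Z - 3 &
         exists2 x : ring_of_integers K, irreducible_elt x &
           \prod_(i in I) (p i : ideal (ring_of_integers K)) = principal x]).
Proof.
move=> cyc prime_p hm /number_of_classes_transversal[B cB pB].
have [g [gh [log gK logK]]] := cyc.
have h0 : (0 < h)%N by case: (log 1%g) => k; apply: leq_ltn_trans.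
case: h h0 cyc hm g gh log gK logK => // n _ cyc nm g gh log gK logK.
(* The discrete logarithm to base [g], with values in the integers modulo [h = n.+1], carries
   distinct classes to distinct residues. *)
pose f i := log (ideal_class (p i)).
have fB : {in B &, injective f}.
  by move=> i j iB jB /(can_inj logK); apply: pB.
have nT : (n < #|'I_m|)%N by rewrite card_ord.
have irr L : short_zero_sum f L -> exists I : {set 'I_m},
     [/\ I != set0, (#|I| <= L)%N &
         exists2 x : ring_of_integers K, irreducible_elt x &
           \prod_(i in I) (p i : ideal (ring_of_integers K)) = principal x].
  case=> I [I0 IL fI].
  have [|J /andP[J0 JI] Jx] := irreducible_minimal_product cyc prime_p I0.
    have [|A EA cA] := @class_prod _ _ p g (fun i => f i : nat) (enum I).
      by move=> i; rewrite logK.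
    have [|a Ea] := @class_one_principal _ A; last first.
      by exists a; rewrite -Ea EA big_enum.
    (* A zero sum modulo [n.+1] means that the exponent of [g], computed in the natural numbers, is
       a multiple of [n.+1]; the product then has trivial class. *)
    rewrite cA; have : (n.+1 %| \sum_(i <- enum I) f i)%N.
      have := congr1 val fI; rewrite -big_enum /=.
      suff -> s : val (\sum_(i <- s) f i) = ((\sum_(i <- s) f i)%N %% n.+1)%N.
        by move=> /eqP.
      elim: s => [|i s IHs]; first by rewrite !big_nil mod0n.
      by rewrite !big_cons -modnDmr -IHs.
    by case/dvdnP=> q ->; rewrite mulnC expgnA gh expg1n.
  exists J; split=> //; apply: leq_trans IL; exact: subset_leq_card.
split.
  have [L /irr[I [I0 IL Ix]] LB] := short_zero_sum_bound fB nT.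
  by exists I; split=> //; rewrite -cB; apply: le_trans LB; rewrite lez_nat.
rewrite -cB => n4 cB3; have /irr[I [I0 IL Ix]] := short_zero_sum_three fB nT cB3 n4.
by exists I; split=> //; lia.
Qed.
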